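(* Let $n\ge 2$, let $z\in\mathbb{R}^n$, let $D=\mathbb{R}^n\setminus\{z\}$, and let $x\in D$. Then for every $r>\log 3$ the metric ball $B_{\tau_z}(x,r)$ is not convex (as a subset of $\mathbb{R}^n$).
   Context: For $z\in\mathbb{R}^n$, the scale-invariant Cassinian metric on $\mathbb{R}^n\setminus\{z\}$ is $$\tau_z(x,y)=\log\left(1+2\frac{|x-y|}{\sqrt{|x-z|\,|y-z|}}\right),\quad x,y\in\mathbb{R}^n\setminus\{z\},$$ where $|\cdot|$ is the Euclidean norm, and $B_{\tau_z}(x,r)=\{y\in\mathbb{R}^n\setminus\{z\}:\tau_z(x,y)<r\}$. *)

(* Defs.v *)
From HB Require Import structures.
From mathcomp Require Import all_boot all_order all_algebra.
From mathcomp Require Import all_classical all_reals all_analysis.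

Set Implicit Arguments.
Unset Strict Implicit.
Unset Printing Implicit Defensive.

Import Order.TTheory GRing.Theory Num.Theory.

Local Open Scope classical_set_scope.
Local Open Scope ring_scope.

(* Not `|x|, which is the sup norm on row vectors. *)
Definition eucl_norm (R : realType) (n : nat) (x : 'rV[R]_n) : R :=
  Num.sqrt (\sum_(i < n) x ord0 i ^+ 2).

(* Only meaningful for x and y distinct from z: division by 0 yields 0, so
   that tau z x z = 0. *)
Definition tau (R : realType) (n : nat) (z x y : 'rV[R]_n) : R :=
  ln (1 + 2 * (eucl_norm (x - y)
               / Num.sqrt (eucl_norm (x - z) * eucl_norm (y - z)))).

Definition tau_ball (R : realType) (n : nat) (z x : 'rV[R]_n) (r : R) :
    set 'rV[R]_n :=
  [set y | y != z /\ tau z x y < r].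

(* Main.v *)
(* Translate and rescale so that z = 0 and |x| = 1, and put T = ((e^r - 1)/2)^2,
   so that r > log 3 means T > 1 and y lies in the ball iff |x - y|^2 < T |y|.
   The ball is symmetric about the line through 0 and x, so it suffices to find
   two points p x + q e and p x - q e (with e a unit vector orthogonal to x) in
   the ball whose midpoint p x is outside.  If T > 2 take p = 0, q = 1: the
   midpoint is the puncture.  If T <= 2, a point of the sphere |y| = s lies in the
   ball iff p > (s^2 + 1 - T s)/2; this bound is smallest for s = T/2, and p
   slightly above it gives p x outside the ball, i.e. T p <= (1 - p)^2. *)
Require Import Defs.
From HB Require Import structures.
From mathcomp Require Import all_boot all_order all_algebra.
From mathcomp Require Import all_classical all_reals all_analysis.
From mathcomp Require Import ring lra.

Import Order.TTheory GRing.Theory Num.Theory.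

Local Open Scope classical_set_scope.
Local Open Scope ring_scope.

(** The quarter turn (w_j, -w_i) in a coordinate plane with w_i nonzero is orthogonal to [w]; the
    factor [c] gives it the norm of [w]. *)
Lemma exists_orthogonal_same_norm (R : realType) (n : nat) (w : 'rV[R]_n) :
  (2 <= n)%N -> w != 0 ->
  exists e : 'rV[R]_n, \sum_(i < n) w ord0 i * e ord0 i = 0 /\
    \sum_(i < n) e ord0 i ^+ 2 = \sum_(i < n) w ord0 i ^+ 2.
Proof.
move=> n2 /rV0Pn[i wi0].
have [j ji] : exists j : 'I_n, j != i.
  have : (0 < #|predC1 i|)%N.
    by rewrite cardC1 card_ord; case: n n2 {w wi0 i} => [|[]].
  by case/card_gt0P => j; exists j.
set S := \sum_(k < n) w ord0 k ^+ 2.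
have S0 : 0 <= S by apply: sumr_ge0 => k _; exact: sqr_ge0.
pose N := w ord0 i ^+ 2 + w ord0 j ^+ 2.
have N0 : 0 < N by rewrite ltr_pwDl ?sqr_ge0// exprn_even_gt0.
pose c := Num.sqrt (S / N).
exists (\row_k (c * (if k == i then w ord0 j else if k == j then - w ord0 i else 0))).
split.
  rewrite (bigD1 i)//= (bigD1 j)//= big1 => [|k /andP[ki kj]].
    by rewrite !mxE !eqxx (negbTE ji); ring.
  by rewrite mxE (negbTE ki) (negbTE kj) !mulr0.
rewrite (bigD1 i)//= (bigD1 j)//= big1 => [|k /andP[ki kj]].
  rewrite !mxE !eqxx (negbTE ji) !exprMn sqr_sqrtr ?divr_ge0 ?(ltW N0)//.
  rewrite sqrrN addr0 -mulrDr [X in _ * X](_ : _ = N) ?divfK ?gt_eqF//.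
  by rewrite addrC.
by rewrite mxE (negbTE ki) (negbTE kj) mulr0 expr0n.
Qed.

(** Pythagoras, with the common norm of [w] and [e] factored out. *)
Lemma eucl_norm_comb (R : realType) (n : nat) (w e : 'rV[R]_n) (a b : R) :
  \sum_(i < n) w ord0 i * e ord0 i = 0 ->
  \sum_(i < n) e ord0 i ^+ 2 = \sum_(i < n) w ord0 i ^+ 2 ->
  eucl_norm (a *: w + b *: e) = eucl_norm w * Num.sqrt (a ^+ 2 + b ^+ 2).
Proof.
move=> we ee; rewrite /eucl_norm -sqrtrM; last first.
  by apply: sumr_ge0 => k _; exact: sqr_ge0.
congr Num.sqrt.
transitivity (a ^+ 2 * (\sum_(i < n) w ord0 i ^+ 2) +
  2 * a * b * (\sum_(i < n) w ord0 i * e ord0 i) +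
  b ^+ 2 * (\sum_(i < n) e ord0 i ^+ 2)); last by rewrite we ee; ring.
rewrite !mulr_sumr -!big_split/=; apply: eq_bigr => i _; rewrite !mxE; ring.
Qed.

Lemma eucl_norm_gt0 (R : realType) (n : nat) (w : 'rV[R]_n) :
  w != 0 -> 0 < eucl_norm w.
Proof.
move=> /rV0Pn[i wi0]; rewrite sqrtr_gt0 (bigD1 i)//= ltr_pwDl//.
  by rewrite exprn_even_gt0.
by apply: sumr_ge0 => k _; exact: sqr_ge0.
Qed.

(** Every distance carries the factor |w|, which cancels by scale invariance. Solving for the square
    root and squaring is reversible since e^r >= 1. *)
Lemma tau_comb_lt (R : realType) (n : nat) (z w e : 'rV[R]_n) (a b r : R) :
  0 <= r -> w != 0 ->
  \sum_(i < n) w ord0 i * e ord0 i = 0 ->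
  \sum_(i < n) e ord0 i ^+ 2 = \sum_(i < n) w ord0 i ^+ 2 ->
  0 < a ^+ 2 + b ^+ 2 ->
  (tau z (z + w) (z + (a *: w + b *: e)) < r) =
  ((1 - a) ^+ 2 + b ^+ 2 <
   ((expR r - 1) / 2) ^+ 2 * Num.sqrt (a ^+ 2 + b ^+ 2)).
Proof.
move=> r0 w0 we ee ab0; rewrite /tau.
have -> : z + w - (z + (a *: w + b *: e)) = (1 - a) *: w + (- b) *: e.
  by rewrite opprD addrACA subrr add0r scalerBl scale1r scaleNr opprD addrA.
rewrite (addrC z w) addrK (addrC z (_ + _)) addrK !eucl_norm_comb// sqrrN.
have := eucl_norm_gt0 R n w w0; set L := eucl_norm w => L0.
set A := (1 - a) ^+ 2 + b ^+ 2; set s := Num.sqrt (a ^+ 2 + b ^+ 2).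
have s0 : 0 < s by rewrite sqrtr_gt0.
have A0 : 0 <= A by rewrite addr_ge0 ?sqr_ge0.
have T0 : 0 <= (expR r - 1) / 2.
  by rewrite divr_ge0// subr_ge0 -expR0 ler_expR.
rewrite (mulrA L L) -expr2 sqrtrM ?sqr_ge0// sqrtr_sqr gtr0_norm// invfM mulrACA.
rewrite divff ?gt_eqF// mul1r -sqrtrV ?(ltW s0)// -sqrtrM//.
set u := Num.sqrt _; have u0 : 0 <= u by exact: sqrtr_ge0.
rewrite -[X in _ < X]expRK ltr_ln ?posrE ?expR_gt0//; last by lra.
have -> : (1 + 2 * u < expR r) = (u < (expR r - 1) / 2).
  by apply/idP/idP; lra.
by rewrite -ltr_sqr ?nnegrE// sqr_sqrtr ?divr_ge0 ?(ltW s0)// ltr_pdivrMr.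
Qed.

(* For 1 <= T <= 2 and p = (1 - T^2/4)/2 the slack (1 - p)^2 - T p is at least
   1/64 (attained at T = 1), and its slope in p is at least -4; hence the shift
   of p by 1/400. *)
Lemma exists_chord (R : realType) (T : R) : 1 < T ->
  exists p q : R, [/\ 0 < p ^+ 2 + q ^+ 2,
    (1 - p) ^+ 2 + q ^+ 2 < T * Num.sqrt (p ^+ 2 + q ^+ 2) &
    p = 0 \/ 0 < p /\ T * p <= (1 - p) ^+ 2].
Proof.
move=> T1; have [T2|T2] := ltP 2 T.
  exists 0, 1; rewrite expr0n/= add0r subr0 !expr1n sqrtr1.
  by split; [lra|lra|left].
pose p := (1 - T ^+ 2 / 4) / 2 + 1 / 400.
have p0 : 0 < p by rewrite /p; nra.
have pT : p <= T / 2 by rewrite /p; nra.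
have q2 : 0 <= (T / 2) ^+ 2 - p ^+ 2 by nra.
(* This [q] puts (p, q) on the circle of radius T/2, which makes the ball condition linear in
   [p]. *)
exists p, (Num.sqrt ((T / 2) ^+ 2 - p ^+ 2)).
rewrite sqr_sqrtr// addrCA subrr addr0 sqrtr_sqr gtr0_norm; last by lra.
split; [by nra|by rewrite /p; nra|right; split=> //].
by rewrite /p; nra.
Qed.

Lemma convex_set_midpoint (R : numFieldType) (M : lmodType R)
    (A : set (convex_lmodType M)) (u v : M) :
  convex_set A -> (u : convex_lmodType M) \in A ->
  (v : convex_lmodType M) \in A ->
  (2^-1 *: (u + v) : convex_lmodType M) \in A.
Proof.
move=> cA uA vA.
have half0 : 0 <= 2^-1 :> R by rewrite invr_ge0.
have half1 : 2^-1 <= 1 :> R by rewrite invf_le1 ?ler1n.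
have := cA u v (Itv01 half0 half1) uA vA.
suff -> : 2^-1 *: (u + v) = 2^-1 *: u + (1 - 2^-1) *: v by [].
by rewrite scalerDr; congr (_ + _ *: _); field.
Qed.

Theorem theorem6p1 (R : realType) (n : nat) (z x : 'rV[R]_n) (r : R)
    (hn : (2 <= n)%N) (hx : x != z) (hr : ln 3 < r) :
  ~ convex_set (tau_ball z x r).
Proof.
have w0 : x - z != 0 by rewrite subr_eq0.
move: (x - z) w0 (subrKC z x) => w w0 <- {x hx}.
have [e [we ee]] := exists_orthogonal_same_norm R n w hn w0.
have r0 : 0 <= r by rewrite (le_trans _ (ltW hr))// ln_ge0; lra.
have tau_lt a b := tau_comb_lt R n z w e a b r r0 w0 we ee.
set T := ((expR r - 1) / 2) ^+ 2 in tau_lt.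
have T1 : 1 < T.
  have : 3 < expR r by rewrite -[ltLHS]lnK ?posrE// ltr_expR.
  by rewrite /T => ?; nra.
have [p [q [pq0 pqT p_out]]] := exists_chord R T T1.
(* Stated for [b] so as to cover both endpoints, b = q and b = -q. *)
have in_ball b : b ^+ 2 = q ^+ 2 ->
    z + (p *: w + b *: e) \in tau_ball z (z + w) r.
  move=> bq; rewrite inE; split; last by rewrite tau_lt bq.
  rewrite -subr_eq0 addrAC subrr add0r; apply/eqP => c0.
  have := eucl_norm_comb R n w e p b we ee.
  rewrite c0 bq {1}/eucl_norm big1 => [|i _]; last by rewrite mxE expr0n.
  rewrite sqrtr0 => /esym/eqP; apply/negP.
  by rewrite mulf_neq0 ?gt_eqF ?eucl_norm_gt0 ?sqrtr_gt0.
move=> /convex_set_midpoint/(_ (in_ball q erefl) (in_ball (- q) (sqrrN q))).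
have -> : 2^-1 *: (z + (p *: w + q *: e) + (z + (p *: w + - q *: e))) =
    z + (p *: w + 0 *: e).
  by apply/rowP => i; rewrite !mxE; field.
(* If p = 0 the midpoint is [z], where [tau] takes the default value 0 < r; only the condition y !=
   z excludes it. *)
rewrite inE => -[]; case: p_out => [->|[p1 p_out]].
  by rewrite !scale0r !addr0 eqxx.
move=> _; rewrite tau_lt ?expr0n ?addr0 ?exprn_gt0//.
by rewrite sqrtr_sqr gtr0_norm// ltNge p_out.
Qed.
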